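(* Let $A\geq a\geq 1$ and $r\geq 2$ be integers. For $n\geq0$ let $\sigma\overline{mes}_{r,A,a}(n)=\sum_{\pi\in\overline{\mathcal{P}}(n)}\overline{mes}_{r,A,a}(\pi)$. Then \[ \sum_{n=0}^\infty\sigma\overline{mes}_{r,A,a}(n)q^{n} =\frac{(-q;q)_{\infty}}{(q;q)_{\infty}}\bigg[a+A\sum_{k=1}^{\infty}\frac{q^{r[A\binom{k}{2}+ka]}}{(-q^{a};q^{A})_{k}}\bigg]. \]
   Context: An overpartition is a partition (finite non-increasing sequence of positive integers) in which the first occurrence of each part value may be overlined; $\overline{\mathcal{P}}(n)$ is the set of overpartitions of $n$. A part is of size $t$ if it equals $t$ or $\overline{t}$. $(a;q)_\infty=\prod_{i\geq0}(1-aq^i)$, $(a;q)_n=(a;q)_\infty/(aq^n;q)_\infty$; $|q|<1$. For $r\geq2$, $\overline{mes}_{r,A,a}(\pi)$ is the smallest positive integer $m\equiv a\pmod A$ such that either $\pi$ has no overlined part $\overline{m}$ or $\pi$ has fewer than $r-1$ non-overlined parts equal to $m$. *)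

(* Defs.v *)
From mathcomp Require Import all_boot all_order all_algebra.
From mathcomp Require Import all_classical all_reals.
From mathcomp Require Import topology normedtype sequences.
From mathcomp Require Import complex.

Set Implicit Arguments.
Unset Strict Implicit.
Unset Printing Implicit Defensive.

Import Order.TTheory GRing.Theory Num.Theory.
Import numFieldNormedType.Exports.

Local Open Scope classical_set_scope.
Local Open Scope ring_scope.

(* A part is a pair (size, overlined?).  The pairwise condition says that an
   overlined part is not preceded by a part of the same size. *)
Definition is_overpartition (p : seq (nat * bool)) : bool :=
  [&& sorted geq (map fst p), all (fun x => 0 < x.1)%N p
    & pairwise (fun x y => y.2 ==> (x.1 != y.1)) p].

Definition overpartitions (n : nat) : set (seq (nat * bool)) :=
  [set p | is_overpartition p /\ sumn (map fst p) = n].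

Lemma finite_overpartitions n : finite_set (overpartitions n).
Proof.
pose T : finType := {bseq n of 'I_n.+1 * bool}.
pose f (t : T) : seq (nat * bool) := [seq (val x.1, x.2) | x <- t].
apply: (@sub_finite_set _ _ (f @` [set: T])); last first.
  exact/finite_image/finite_finset.
move=> p [/and3P[_ pos _] sump].
have le_size : (size p <= n)%N.
  rewrite -sump; elim: p pos {sump} => //= x p IHp /andP[x0 /IHp].
  by move=> /(leq_add x0); rewrite add1n.
have le_part x : x \in p -> (x.1 < n.+1)%N.
  move=> xp; rewrite ltnS -sump; elim: p xp {sump pos le_size} => //= y p IHp.
  rewrite inE => /orP[/eqP-> | /IHp le]; first exact: leq_addr.
  exact: leq_trans le (leq_addl _ _).
pose g (x : nat * bool) : 'I_n.+1 * bool := (inord x.1, x.2).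
have szg : (size (map g p) <= n)%N by rewrite size_map.
exists (Bseq szg) => //; rewrite /f /= -map_comp map_id_in// => -[x b] xp /=.
by rewrite inordK// (le_part _ xp).
Qed.

Definition mes_cond (r A a : nat) (p : seq (nat * bool)) (m : nat) : bool :=
  [&& (0 < m)%N, m == a %[mod A]
    & ((m, true) \notin p) || (count_mem (m, false) p < r - 1)%N].

Lemma mes_cond_ex (r A a : nat) (p : seq (nat * bool)) :
  (0 < A)%N -> exists m, mes_cond r A a p m.
Proof.
move=> A0; pose s := sumn (map fst p); exists (s.+1 * A + a)%N.
have lt_s : (s < s.+1 * A + a)%N.
  by rewrite (leq_trans _ (leq_addr _ _))// leq_pmulr.
rewrite /mes_cond modnMDl eqxx (leq_ltn_trans _ lt_s)//=; apply/orP; left.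
apply/negP => ip; suff : (s.+1 * A + a <= s)%N by rewrite leqNgt lt_s.
rewrite {}/s in ip lt_s *; set m := (_ + a)%N in ip *; move: m ip => m ip.
elim: p ip {lt_s} => //= y p IHp.
rewrite inE => /orP[/eqP<- | /IHp le]; first exact: leq_addr.
exact: leq_trans le (leq_addl _ _).
Qed.

(* The default value 0 is only taken when A = 0, by mes_cond_ex. *)
Definition mes (r A a : nat) (p : seq (nat * bool)) : nat :=
  if pselect (exists m, mes_cond r A a p m) is left ex_m then ex_minn ex_m
  else 0%N.

Lemma mesP (r A a : nat) (p : seq (nat * bool)) : (0 < A)%N ->
  mes_cond r A a p (mes r A a p) /\
  forall m, mes_cond r A a p m -> (mes r A a p <= m)%N.
Proof.
move=> /(@mes_cond_ex r A a p) ex_m; rewrite /mes.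
by case: pselect => // {}ex_m; case: ex_minnP.
Qed.

Definition sigma_mes (r A a n : nat) : nat :=
  \big[addn/0%N]_(p \in overpartitions n) mes r A a p.

(* R[i] itself carries no topology instance: the norm topology is attached to
   the carriers of abstract numFieldTypes. *)
Definition complexField (R : realType) : numFieldType := R[i].

Definition qpoch_inf (K : numFieldType) (x q : K) : K :=
  limn (fun n => \prod_(0 <= i < n) (1 - x * q ^+ i)).

Definition qpoch (K : numFieldType) (x q : K) (n : nat) : K :=
  qpoch_inf x q / qpoch_inf (x * q ^+ n) q.

(* Main.v *)
Require Import Defs.
From mathcomp Require Import all_boot all_order all_algebra.
From mathcomp Require Import all_classical all_reals.
From mathcomp Require Import topology normedtype sequences exp.
From mathcomp Require Import complex.
From mathcomp Require Import ring lra zify.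

Import Order.TTheory GRing.Theory Num.Theory.
Import numFieldNormedType.Exports.

Local Open Scope classical_set_scope.
Local Open Scope ring_scope.

(* Call a size m full in an overpartition if m is overlined and has at least
   r - 1 non-overlined copies. The excludant is a + j A, where j is the number
   of k >= 1 such that a, a + A, ..., a + (k - 1) A are all full. Replacing the
   factor (1 + q^m) / (1 - q^m) of the overpartition product by
   q^(r m) / (1 - q^m) for each of these k sizes gives the k-th term of the
   series. To stay with finite sums, overpartitions are cut to sizes and
   multiplicities bounded by N; with t = sqrt |q| the k-th truncated generating
   function is bounded by C t^k uniformly in N, so Tannery's theorem applies as
   N tends to infinity. *)

(** * The complex modulus as a real number, and convergence through it *)

Lemma ler_norm_sqrt_sumsq (F : rcfType) (x y : F) :
  `|y| <= Num.sqrt (x ^+ 2 + y ^+ 2).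
Proof.
rewrite -sqrtr_sqr; apply: ler_wsqrtr.
by rewrite lerDr sqr_ge0.
Qed.

Lemma sqrt_sumsq_le (F : rcfType) (x y : F) :
  Num.sqrt (x ^+ 2 + y ^+ 2) <= `|x| + `|y|.
Proof.
rewrite -[leRHS]ger0_norm ?addr_ge0// -(sqrtr_sqr (_ + _)); apply: ler_wsqrtr.
rewrite sqrrD !real_normK ?num_real//.
by rewrite -addrA (addrC (_ *+ 2)) addrA lerDl mulrn_wge0 // mulr_ge0.
Qed.

(** The norm on [complexField R] takes values in the field itself; a real-valued modulus gives
    access to squeezing and [expR] in [R]. *)
Definition modc {R : realType} (z : complexField R) : R := complex.Re `|z|.

Section Modulus.
Context {R : realType}.
Local Notation K := (complexField R).
Implicit Types z w : K.

Lemma modcK z : ((modc z)%:C%C : K) = `|z|.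
Proof. exact/RRe_real/normr_real. Qed.

Lemma modc_le z (e : R) : (modc z <= e) = (`|z| <= (e%:C%C : K)).
Proof. by rewrite -modcK -lecR. Qed.

Lemma modc_lt z (e : R) : (modc z < e) = (`|z| < (e%:C%C : K)).
Proof. by rewrite -modcK -ltcR. Qed.

Lemma modc_ge0 z : 0 <= modc z.
Proof. by rewrite -lecR modcK normr_ge0. Qed.

Lemma modc0 : modc (0 : K) = 0. Proof. by rewrite /modc normr0. Qed.

Lemma modc1 : modc (1 : K) = 1. Proof. by rewrite /modc normr1. Qed.

Lemma modcN z : modc (- z) = modc z. Proof. by rewrite /modc normrN. Qed.

Lemma modcM z w : modc (z * w) = modc z * modc w.
Proof.
apply: (@complexI R); rewrite rmorphM.
by rewrite -[LHS]/((modc (z * w))%:C%C : K) modcK normrM -!modcK.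
Qed.

Lemma modcX z n : modc (z ^+ n) = modc z ^+ n.
Proof. by elim: n => [|n IHn]; rewrite ?expr0 ?modc1 // !exprS modcM IHn. Qed.

Lemma modcV z : modc z^-1 = (modc z)^-1.
Proof.
apply: (@complexI R); rewrite fmorphV.
by rewrite -[LHS]/((modc z^-1)%:C%C : K) modcK normfV -!modcK.
Qed.

Lemma modc_add z w : modc (z + w) <= modc z + modc w.
Proof. by rewrite modc_le rmorphD [X in _ <= X](_ : _ = `|z| + `|w|) ?ler_normD // -!modcK. Qed.

Lemma modc_sum (I : Type) (s : seq I) (P : pred I) (F : I -> K) :
  modc (\sum_(i <- s | P i) F i) <= \sum_(i <- s | P i) modc (F i).
Proof.
elim/big_ind2 : _ => [|x x' y y' lx ly|//]; first by rewrite modc0.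
exact: le_trans (modc_add _ _) (lerD lx ly).
Qed.

Lemma modc_ge_Re z : `|complex.Re z| <= modc z.
Proof. by rewrite -lecR modcK; exact: normc_ge_Re. Qed.

Lemma modcE z : modc z = Num.sqrt (complex.Re z ^+ 2 + complex.Im z ^+ 2).
Proof. by rewrite /modc normc_def. Qed.

Lemma modc_ge_Im z : `|complex.Im z| <= modc z.
Proof. by rewrite modcE; exact: ler_norm_sqrt_sumsq. Qed.

Lemma modc_le_ReIm z : modc z <= `|complex.Re z| + `|complex.Im z|.
Proof. by rewrite modcE; exact: sqrt_sumsq_le. Qed.

Lemma modc_gt0 z : (0 < modc z) = (z != 0).
Proof. by rewrite -ltcR modcK normr_gt0. Qed.

Lemma cvg_modc (u : nat -> K) (l : K) :
  u @ \oo --> l <-> (fun n => modc (u n - l)) @ \oo --> (0 : R).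
Proof.
split=> [/cvgrPdist_lt ul|/cvgrPdist_lt ul].
  apply/cvgrPdist_lt => e e0.
  have e0' : 0 < (e%:C%C : K) by rewrite ltcR.
  near=> n.
  rewrite sub0r normrN ger0_norm ?modc_ge0// modc_lt distrC.
  by near: n; exact: ul.
apply/cvgrPdist_lt => e e0.
have eE : ((modc e)%:C%C : K) = e by rewrite modcK gtr0_norm.
have e0' : 0 < modc e by rewrite modc_gt0 gt_eqF.
near=> n.
rewrite distrC -eE -modc_lt -[X in X < _]ger0_norm ?modc_ge0//.
rewrite -normrN -sub0r.
by near: n; exact: ul.
Unshelve. all: by end_near. Qed.

Lemma cvg_modc_squeeze (u : nat -> K) (l : K) (v : nat -> R) :
  (\forall n \near \oo, modc (u n - l) <= v n) -> v @ \oo --> (0 : R) ->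
  u @ \oo --> l.
Proof.
move=> uv v0; apply/cvg_modc; apply: (squeeze_cvgr _ (cvg_cst 0) v0).
by near=> n; rewrite modc_ge0 /=; near: n.
Unshelve. all: by end_near. Qed.

Lemma cvgn_lim (u : nat -> K) (l : K) : u @ \oo --> l -> limn u = l.
Proof. exact/cvg_lim/norm_hausdorff. Qed.

Lemma is_cvgn (u : nat -> K) (l : K) : u @ \oo --> l -> cvgn u.
Proof. exact: cvgP. Qed.

Lemma cvgn_near_eq (u v : nat -> K) (l : K) :
  (\forall n \near \oo, u n = v n) -> u @ \oo --> l -> v @ \oo --> l.
Proof. by move=> uv; apply: cvg_trans; exact: near_eq_cvg. Qed.

End Modulus.

(** * Series dominated by a geometric series, and Tannery's theorem *)

Section Geometric.
Context {R : realType} (t : R).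
Hypotheses (t0 : 0 <= t) (t1 : t < 1).
Local Notation K := (complexField R).

Lemma cvg_expr0 : (fun n => t ^+ n) @ \oo --> (0 : R).
Proof. by apply: cvg_expr; rewrite ger0_norm. Qed.

Lemma sum_expr_le m n : \sum_(m <= i < n) t ^+ i <= t ^+ m / (1 - t).
Proof.
have t1' : 0 < 1 - t by rewrite subr_gt0.
have [nm|/ltnW mn] := leqP n m; first by rewrite big_geq// divr_ge0 ?exprn_ge0// ltW.
rewrite ler_pdivlMr// mulr_suml (telescope_sumr_eq (fun i => - t ^+ i))//.
  by rewrite opprK addrC gerDl oppr_le0 exprn_ge0.
by move=> k _; rewrite exprS; ring.
Qed.

(** Real and imaginary parts are bounded by the modulus, so each gives an absolutely convergent real
    series. *)
Lemma cvgn_dominated m (L : nat -> K) (C : R) :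
  (forall k, modc (L k) <= C * t ^+ k) ->
  cvgn (fun N => \sum_(m <= k < N) L k).
Proof.
move=> LC.
have C0 k : 0 <= C * t ^+ k by exact: le_trans (modc_ge0 _) (LC k).
have cC : cvgn (series (geometric C t)) by apply: is_cvg_geometric_series; rewrite ger0_norm.
have cR (f : K -> R) : (forall z, `|f z| <= modc z) -> cvgn (series (f \o L)).
  move=> fz; apply: normed_cvg; apply: series_le_cvg cC => n /=; first exact: normr_ge0.
    exact: C0.
  exact: le_trans (fz _) (LC n).
have /cvg_ex[/= x cx] := cR _ (@modc_ge_Re R).
have /cvg_ex[/= y cy] := cR _ (@modc_ge_Im R).
rewrite (is_cvg_series_restrict m L).
apply: (@cvgP _ _ ((x +i* y)%C : K)).
apply: (@cvg_modc_squeeze _ _ _ (fun n =>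
  `|series ((@complex.Re R : K -> R) \o L) n - x| +
  `|series ((@complex.Im R : K -> R) \o L) n - y|)).
  apply: nearW => n; apply: le_trans (modc_le_ReIm _) _.
  have E : series L n =
      (series ((@complex.Re R : K -> R) \o L) n +i* series ((@complex.Im R : K -> R) \o L) n)%C :> K.
    rewrite /series /=; elim: n => [|n IHn]; first by rewrite !big_geq.
    by rewrite !big_nat_recr//= IHn; case: (L n).
  by rewrite E.
rewrite -[0]addr0; apply: cvgD; apply/norm_cvg0P; exact/subr_cvg0.
Qed.

(** Past a fixed index [k0] the differences contribute less than [e / 2] uniformly in [N], by the
    geometric bound; the finitely many others tend to 0. *)
Lemma tannery m (u : nat -> nat -> K) (L : nat -> K) (C : R) :
  (forall N k, modc (u N k) <= C * t ^+ k) ->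
  (forall k, u ^~ k @ \oo --> L k) ->
  cvgn (fun N => \sum_(m <= k < N) L k) /\
  (fun N => \sum_(m <= k < N) u N k) @ \oo --> limn (fun N => \sum_(m <= k < N) L k).
Proof.
move=> uC uL.
(* The bound survives in the limit, so [u N k - L k] is dominated with constant [2 * C]. *)
have LC k : modc (L k) <= C * t ^+ k.
  apply/ler_addgt0Pr => e e0.
  have /cvg_modc/cvgrPdist_lt/(_ _ e0)[n _ /(_ n (leqnn n))] := uL k.
  rewrite sub0r normrN ger0_norm ?modc_ge0// => ule.
  rewrite -(subrK (u n k) (L k)) addrC; apply: le_trans (modc_add _ _) _.
  by apply: lerD => //; rewrite -modcN opprB ltW.
have cL := cvgn_dominated m _ _ LC; split => //.
have C0 : 0 <= C by have := LC 0; rewrite expr0 mulr1; exact/le_trans/modc_ge0.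
apply: (@cvg_sub0 K K nat \oo _ _ (fun N => \sum_(m <= k < N) L k) _ _ cL).
apply/(@cvg_modc R)/cvgrPdist_lt => e e0.
have t1' : 0 < 1 - t by rewrite subr_gt0.
have e20 : 0 < e / 2 by rewrite divr_gt0.
have [k0 _ k0P] : \forall k \near \oo, (2 * C) * (t ^+ k / (1 - t)) < e / 2.
  have : (fun k => (2 * C) * (t ^+ k / (1 - t))) @ \oo --> (2 * C * (0 / (1 - t)) : R).
    by apply: cvgMr; apply: cvgMl; exact: cvg_expr0.
  rewrite mul0r mulr0 => /cvgrPdist_lt/(_ _ e20).
  by apply: filterS => k; rewrite sub0r normrN; apply/le_lt_trans/ler_norm.
have fin : (fun N => \sum_(m <= k < k0) modc (u N k - L k)) @ \oo --> (0 : R).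
  rewrite [X in _ --> X](_ : _ = \sum_(m <= k < k0) (0 : R)); last by rewrite big1.
  apply: cvg_big => [|k _]; first exact: add_continuous.
  by have /cvg_modc := uL k.
near=> N.
rewrite sub0r normrN subr0 ger0_norm ?modc_ge0//= -[X in modc X]sumrB.
have k0N : (k0 <= N)%N by near: N; exact: nbhs_infty_ge.
have -> : e = e / 2 + e / 2 by lra.
(* The maximum covers both positions of the lower summation index: [j = 0] serves [m <= k0], and
   [j = m] serves [k0 < m], where everything is tail. *)
have tail j : \sum_(maxn k0 j <= k < N) modc (u N k - L k) < e / 2.
  apply: le_lt_trans (k0P _ (leq_maxl k0 j)).
  apply: (@le_trans _ _ (\sum_(maxn k0 j <= k < N) (2 * C) * t ^+ k)).
    apply: ler_sum => k _; apply: le_trans (modc_add _ _) _; rewrite modcN.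
    by rewrite -mulrA mulr_natl mulr2n lerD.
  by rewrite -mulr_sumr ler_wpM2l ?sum_expr_le// mulr_ge0.
apply: le_lt_trans (modc_sum _ _ _ _) _.
have [mk0|k0m] := leqP m k0.
  rewrite (big_cat_nat mk0 k0N) ltrD//.
    near: N; move/cvgrPdist_lt: fin => /(_ _ e20).
    by apply: filterS => N; rewrite sub0r normrN; apply/le_lt_trans/ler_norm.
  by have := tail 0; rewrite maxn0.
have := tail m; rewrite (maxn_idPr (ltnW k0m)) => /lt_trans -> //.
by rewrite ltrDl.
Unshelve. all: by end_near. Qed.

End Geometric.

(** * Infinite products of [1 + y i] with geometrically small [y i] *)

Section Products.
Context {R : realType} (t B : R).
Hypotheses (t0 : 0 <= t) (t1 : t < 1) (B0 : 0 <= B).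
Local Notation K := (complexField R).

Lemma prod1D_expr_le n :
  \prod_(0 <= i < n) (1 + B * t ^+ i) <= expR (B / (1 - t)).
Proof.
apply: (@le_trans _ _ (expR (B * \sum_(0 <= i < n) t ^+ i))).
  elim: n => [|n IHn]; first by rewrite !big_geq// mulr0 expR0.
  rewrite !big_nat_recr//= [X in expR X]mulrDr expRD ler_pM ?expR_ge1Dx//.
    by apply: prodr_ge0 => i _; rewrite addr_ge0// mulr_ge0// exprn_ge0.
  by rewrite addr_ge0// mulr_ge0// exprn_ge0.
by rewrite ler_expR ler_wpM2l// (le_trans (sum_expr_le t t0 t1 0 n)) ?expr0 ?div1r.
Qed.

Variable y : nat -> K.
Hypothesis yB : forall i, modc (y i) <= B * t ^+ i.

Lemma modc_prod1D_le n :
  modc (\prod_(0 <= i < n) (1 + y i)) <= expR (B / (1 - t)).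
Proof.
apply: le_trans (prod1D_expr_le n).
elim: n => [|n IHn]; first by rewrite !big_geq// modc1.
rewrite !big_nat_recr//= modcM ler_pM ?modc_ge0//.
by apply: le_trans (modc_add _ _) _; rewrite modc1 lerD2l.
Qed.

(** Telescoping turns partial products into partial sums of a series, to which [cvgn_dominated]
    applies. *)
Lemma prod1DE n : \prod_(0 <= i < n) (1 + y i) =
  1 + \sum_(0 <= j < n) y j * \prod_(0 <= i < j) (1 + y i).
Proof.
elim: n => [|n IHn]; first by rewrite !big_geq// addr0.
by rewrite !big_nat_recr//= mulrDr mulr1 {1}IHn -addrA; congr (_ + (_ + _)); rewrite mulrC.
Qed.

Let term_le j : modc (y j * \prod_(0 <= i < j) (1 + y i)) <=
  B * expR (B / (1 - t)) * t ^+ j.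
Proof. by rewrite modcM mulrAC ler_pM ?modc_ge0// modc_prod1D_le. Qed.

(** The bound tends to 0 with [B], uniformly in [n]; [cvg_gf0] uses it with [B = modc q ^+ N]. *)
Lemma modc_prod1DB1_le n : modc (\prod_(0 <= i < n) (1 + y i) - 1) <=
  B * expR (B / (1 - t)) / (1 - t).
Proof.
rewrite prod1DE addrC addKr; apply: le_trans (modc_sum _ _ _ _) _.
apply: le_trans (ler_sum _ (fun j _ => term_le j)) _.
rewrite -mulr_sumr ler_wpM2l ?mulr_ge0 ?expR_ge0//.
by rewrite (le_trans (sum_expr_le t t0 t1 0 n)) ?expr0 ?div1r.
Qed.

Lemma cvgn_prod1D : cvgn (fun n => \prod_(0 <= i < n) (1 + y i)).
Proof.
have /cvg_ex[/= l cl] := cvgn_dominated t t0 t1 0 _ _ term_le.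
apply: (is_cvgn _ (1 + l)); under eq_fun do rewrite prod1DE.
exact: (@cvgD K K _ _ _ (cst 1) _ 1 l (cvg_cst _) cl).
Qed.

End Products.

(** * Infinite and finite [q]-Pochhammer symbols *)

Section QPochhammer.
Context {R : realType}.
Local Notation K := (complexField R).
Variable q : K.
Hypothesis q1 : modc q < 1.
Implicit Type x : K.

Lemma cvg_qpoch_inf x :
  (fun n => \prod_(0 <= i < n) (1 - x * q ^+ i)) @ \oo --> qpoch_inf x q.
Proof.
apply: (cvgn_prod1D (modc q) (modc x) (modc_ge0 _) q1 (modc_ge0 _)
  (fun i => - (x * q ^+ i))) => i.
by rewrite modcN modcM modcX.
Qed.

Lemma qpoch_factor_ge x i : modc x < 1 -> 1 - modc x <= modc (1 - x * q ^+ i).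
Proof.
move=> x1; rewrite lerBlDr -[leLHS]modc1 -{1}[1](subrK (x * q ^+ i)).
apply: le_trans (modc_add _ _) _; rewrite lerD2l modcM modcX.
by rewrite ler_piMr ?modc_ge0// exprn_ile1 ?modc_ge0// ltW.
Qed.

Lemma qpoch_factor_neq0 x i : modc x < 1 -> 1 - x * q ^+ i != 0.
Proof.
move=> x1; rewrite -modc_gt0; apply: lt_le_trans (qpoch_factor_ge _ i x1).
by rewrite subr_gt0.
Qed.

(* The product of the inverses converges too, so the two limits are inverse to
   each other. *)
Lemma qpoch_inf_neq0 x : modc x < 1 -> qpoch_inf x q != 0.
Proof.
move=> x1; pose y i := x * q ^+ i / (1 - x * q ^+ i).
have x1' : 0 < 1 - modc x by rewrite subr_gt0.
have yB i : modc (y i) <= modc x / (1 - modc x) * modc q ^+ i.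
  rewrite modcM modcV modcM modcX [leRHS]mulrAC ler_wpM2l//.
    by rewrite mulr_ge0 ?exprn_ge0 ?modc_ge0.
  rewrite lef_pV2 ?posrE//; first exact: qpoch_factor_ge.
  by apply: lt_le_trans (qpoch_factor_ge _ i x1).
have /cvg_ex[/= l cl] := cvgn_prod1D (modc q) _ (modc_ge0 _) q1
  (divr_ge0 (modc_ge0 _) (ltW x1')) _ yB.
have /cvgn_lim : (fun=> 1 : K) @ \oo --> qpoch_inf x q * l.
  rewrite [X in X @ _ --> _](_ : _ = (fun n => \prod_(0 <= i < n) (1 - x * q ^+ i))
      \* (fun n => \prod_(0 <= i < n) (1 + y i))).
    exact: cvgM (cvg_qpoch_inf x) cl.
  apply/funext => n /=; rewrite -big_split big1//= => i _.
  by have := qpoch_factor_neq0 _ i x1; rewrite /y => ?; field.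
rewrite lim_cst; last exact: norm_hausdorff.
by move=> e; apply: contra_eq_neq e => ->; rewrite mul0r oner_neq0.
Qed.

(** The first [n] factors split off the numerator, and the remaining tail is the denominator,
    nonzero since [x * q ^+ n] also has modulus below 1. *)
Lemma qpochE x n : modc x < 1 ->
  qpoch x q n = \prod_(0 <= i < n) (1 - x * q ^+ i).
Proof.
move=> x1.
have xn1 : modc (x * q ^+ n) < 1.
  rewrite modcM modcX; apply: le_lt_trans x1.
  by rewrite ler_piMr ?modc_ge0// exprn_ile1 ?modc_ge0// ltW.
rewrite /qpoch; apply/eqP; rewrite eq_sym -(can2_eq (mulfK _) (divfK _)) ?qpoch_inf_neq0//; apply/eqP.
apply/esym/cvgn_lim; rewrite -(cvg_shiftn n).
rewrite [X in X @ _ --> _](_ : _ = fun N => \prod_(0 <= i < n) (1 - x * q ^+ i) *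
   \prod_(0 <= i < N) (1 - x * q ^+ n * q ^+ i)); last first.
  apply/funext => N /=; rewrite (@big_cat_nat _ _ _ n)//= ?leq_addl//.
  congr (_ * _); rewrite -{1}[n]add0n big_addn addnK.
  by apply: eq_bigr => i _; rewrite addnC exprD mulrA.
apply: cvgM; [exact: cvg_cst|exact: cvg_qpoch_inf].
Qed.

End QPochhammer.

(** * Overpartitions encoded by their multiplicities *)

Lemma mem_leq_sumn {T : eqType} (h : T -> nat) (s : seq T) x :
  x \in s -> (h x <= sumn (map h s))%N.
Proof.
elim: s => //= y s IHs; rewrite inE => /orP[/eqP->|/IHs]; first exact: leq_addr.
by move=> /leq_trans; apply; rewrite leq_addl.
Qed.

(** A single relation for the order of sizes and the overlining rule. It fails between equal
    overlined parts, which forbids repeating them; being transitive and antisymmetric, it makes a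
    sorted list depend only on its multiset of parts. *)
Definition precedes (x y : nat * bool) : bool :=
  (y.1 < x.1)%N || (x.1 == y.1) && ~~ y.2.

Lemma precedes_trans : transitive precedes.
Proof. by move=> [y b] [x c] [z d]; rewrite /precedes /=; case: b c d => [] [] []; lia. Qed.

Lemma precedes_anti : antisymmetric precedes.
Proof.
move=> [x b] [y c]; rewrite /precedes /= => xy.
by have [-> -> ->] : [/\ x = y, b = false & c = false] by case: b c xy => [] []; split; lia.
Qed.

Lemma is_overpartitionE p :
  is_overpartition p = sorted precedes p && all (fun x => 0 < x.1)%N p.
Proof.
rewrite /is_overpartition !sorted_pairwise; last first.
- by move=> y x z /=; lia.
- exact: precedes_trans.
rewrite pairwise_map andbCA andbC -pairwise_relI; congr (_ && _).
apply: eq_pairwise => -[x b] [y c]; rewrite /precedes /=.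
by case: c => /=; lia.
Qed.

Definition block (m : nat) (x : bool * nat) : seq (nat * bool) :=
  nseq x.1 (m, true) ++ nseq x.2 (m, false).

(* [g i] records whether size [i.+1] is overlined and how many non-overlined
   copies of it there are. *)
Fixpoint overpart_of (g : nat -> bool * nat) (M : nat) : seq (nat * bool) :=
  if M is M'.+1 then block M (g M') ++ overpart_of g M' else [::].

Lemma mem_block m x y : y \in block m x -> y.1 = m.
Proof. by rewrite mem_cat !mem_nseq => /orP[]/andP[_ /eqP->]. Qed.

Lemma overpart_of_bounds g M x : x \in overpart_of g M -> (0 < x.1 <= M)%N.
Proof.
elim: M => //= M IHM; rewrite mem_cat => /orP[/mem_block->//|/IHM/andP[-> /leqW]//].
by rewrite leqnn.
Qed.

Lemma overpart_ofP g M : is_overpartition (overpart_of g M).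
Proof.
rewrite is_overpartitionE; apply/andP; split; last first.
  by apply/allP => x /overpart_of_bounds/andP[].
rewrite sorted_pairwise; last exact: precedes_trans.
elim: M => //= M IHM; rewrite pairwise_cat IHM andbT; apply/andP; split.
  apply/allrelP => x y /mem_block xM /overpart_of_bounds/andP[_ yM].
  by rewrite /precedes xM ltnS yM.
have nn m c : pairwise precedes (nseq c (m, false)).
  elim: c => //= c ->; rewrite andbT; apply/allP => y /nseqP[-> _].
  by rewrite /precedes /= eqxx orbT.
rewrite /block; case: (g M) => [[] c] /=; rewrite nn // andbT.
by apply/allP => y /nseqP[-> _]; rewrite /precedes /= eqxx orbT.
Qed.

Lemma count_overpart_of g M m b :
  count_mem (m.+1, b) (overpart_of g M) =
    if (m < M)%N then if b then nat_of_bool (g m).1 else (g m).2 else 0%N.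
Proof.
elim: M => //= M IHM; rewrite /block !count_cat !count_nseq IHM /= !xpair_eqE eqSS.
case: (ltngtP M m) => [Mm|mM|<-] {IHM}.
- by rewrite ltnNge Mm.
- by rewrite ltnW.
- by rewrite ltnSn; case: b => /=; lia.
Qed.

Lemma sumn_overpart_of g M : sumn (map fst (overpart_of g M)) =
  (\sum_(i < M) i.+1 * ((g i).1 + (g i).2))%N.
Proof.
elim: M => [|M IHM]; rewrite ?big_ord0// big_ord_recr /= map_cat sumn_cat IHM.
rewrite addnC /block map_cat !map_nseq sumn_cat !sumn_nseq /=; lia.
Qed.

Definition profile (p : seq (nat * bool)) (i : nat) : bool * nat :=
  ((i.+1, true) \in p, count_mem (i.+1, false) p).

Lemma count_overlined p m : is_overpartition p ->
  count_mem (m, true) p = ((m, true) \in p) :> nat.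
Proof.
rewrite is_overpartitionE => /andP[+ _].
rewrite sorted_pairwise; last exact: precedes_trans.
elim: p => //= x p IHp /andP[/allP xp /IHp ->]; rewrite inE (eq_sym x).
have [xE|//] := eqVneq (m, true) x; rewrite -{}xE in xp.
suff /negbTE -> : (m, true) \notin p by [].
apply/negP => /xp; rewrite /precedes /=; lia.
Qed.

(** Both lists are sorted for [precedes], so it suffices to compare multiplicities; membership is
    enough for overlined parts, which occur at most once. *)
Lemma overpart_of_profile p M : is_overpartition p ->
  {in p, forall x, x.1 <= M}%N -> overpart_of (profile p) M = p.
Proof.
move=> op pM; have := op; rewrite is_overpartitionE => /andP[sp /allP pos].
have := overpart_ofP (profile p) M; rewrite is_overpartitionE => /andP[sq _].
apply: (sorted_eq precedes_trans precedes_anti sq sp).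
apply/allP => -[[|m] b] _; apply/eqP.
  have -> : count_mem (0%N, b) p = 0%N by apply/count_memPn/negP => /pos.
  by apply/count_memPn/negP => /overpart_of_bounds.
rewrite count_overpart_of /profile; case: ltnP => [_|Mm]; case: b => //=.
- by rewrite count_overlined.
- by apply/esym/count_memPn/negP => /pM; rewrite /= leqNgt ltnS Mm.
- by apply/esym/count_memPn/negP => /pM; rewrite /= leqNgt ltnS Mm.
Qed.

Lemma eq_overpart_of g h M :
  (forall i, (i < M)%N -> g i = h i) -> overpart_of g M = overpart_of h M.
Proof.
elim: M => //= M IHM gh; rewrite gh// IHM// => i iM.
by apply: gh; rewrite ltnS ltnW.
Qed.

(** * Profiles with sizes at most [N] and fewer than [N] plain copies of each *)

Local Notation profiles N := {ffun 'I_N -> bool * 'I_N}.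

Definition ext {N} (f : profiles N) (i : nat) : bool * nat :=
  if insub i is Some j then ((f j).1, val (f j).2) else (false, 0%N).

Lemma extE N (f : profiles N) (i : 'I_N) : ext f i = ((f i).1, val (f i).2).
Proof. by rewrite /ext valK. Qed.

Definition opart {N} (f : profiles N) := overpart_of (ext f) N.

Definition weight {N} (f : profiles N) : nat :=
  (\sum_(i < N) i.+1 * ((f i).1 + (f i).2))%N.

Lemma sumn_opart N (f : profiles N) : sumn (map fst (opart f)) = weight f.
Proof. by rewrite sumn_overpart_of; apply: eq_bigr => i _; rewrite extE. Qed.

Lemma opart_inj N : injective (@opart N).
Proof.
move=> f g fg; apply/ffunP => i.
have cE (b : bool) (h : profiles N) : count_mem (i.+1, b) (opart h) =
    if b then nat_of_bool (h i).1 else val (h i).2.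
  by rewrite count_overpart_of ltn_ord extE.
have := cE true f; have := cE false f; rewrite fg !cE.
case: (f i) (g i) => [b c] [b' c'] /= /val_inj -> bb.
by case: b b' bb => [] [].
Qed.

(** An overpartition of [n] has sizes and multiplicities at most [n], so a cutoff above [n] loses
    none. *)
Lemma overpartitionsE N n : (n < N)%N ->
  overpartitions n = [set` [seq opart f | f <- enum [pred f : profiles N | weight f == n]]].
Proof.
move=> nN; apply/seteqP; split=> [p [op pn]|p /= /mapP[f]]; last first.
  rewrite mem_enum => /eqP wf ->; split; first exact: overpart_ofP.
  by rewrite sumn_opart.
have N0 : (0 < N)%N by exact: leq_ltn_trans nN.
have pN : {in p, forall x, x.1 <= N}%N.
  by move=> x xp; rewrite (leq_trans _ (ltnW nN))// -pn mem_leq_sumn.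
have cN i : (count_mem (i.+1, false) p < N)%N.
  apply: leq_ltn_trans nN; rewrite -pn.
  elim: p {op pn pN} => //= -[x b] p IHp; rewrite leq_add//.
  by case: x => [|x]; rewrite ?xpair_eqE// (leq_trans (leq_b1 _)).
pose f : profiles N := [ffun i : 'I_N => ((profile p i).1, Ordinal (cN i))].
have fp : opart f = p.
  rewrite -[RHS](overpart_of_profile p N op pN); apply: eq_overpart_of => i iN.
  by have := extE N f (Ordinal iN); rewrite ffunE.
by apply/mapP; exists f; rewrite // mem_enum inE -sumn_opart fp pn.
Qed.

Lemma sigma_mes_profiles r A a N n : (n < N)%N ->
  sigma_mes r A a n = (\sum_(f : profiles N | weight f == n) mes r A a (opart f))%N.
Proof.
move=> nN; rewrite /sigma_mes (overpartitionsE N n nN) -fsbig_seq.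
  by rewrite big_map big_enum.
by rewrite map_inj_uniq ?enum_uniq//; exact: opart_inj.
Qed.

(** * The excludant as a count of full initial segments *)

Section MinimalExcludant.
Variables (r A a : nat).
Hypotheses (a0 : (0 < a)%N) (aA : (a <= A)%N).

Definition full_at (p : seq (nat * bool)) (m : nat) : bool :=
  ((m, true) \in p) && (r - 1 <= count_mem (m, false) p)%N.

Definition full (k : nat) (p : seq (nat * bool)) : bool :=
  all (fun j => full_at p (a + j * A)) (iota 0 k).

(** For positive [k] the last full size is [a + (k - 1) * A], which is at least [k] since [a] and
    [A] are positive. *)
Lemma full_leq k p : full k p -> (k <= sumn (map fst p))%N.
Proof.
case: k => // k /allP/(_ k); rewrite mem_iota add0n ltnSn => /(_ isT)/andP[kp _].
by have := mem_leq_sumn fst _ _ kp; apply: leq_trans => /=; nia.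
Qed.

Lemma mes_cond_progression p m : mes_cond r A a p m ->
  exists2 j, m = (a + j * A)%N & ~~ full_at p m.
Proof.
case/and3P=> m0 mA nfull.
have am : (a <= m)%N.
  (* A positive [m < a] would be its own residue modulo [A], whereas [a] has residue [a], or 0 when
     [a = A]. *)
  rewrite leqNgt; apply/negP => ma; move: mA; rewrite modn_small ?(leq_trans ma)//.
  move: aA; rewrite leq_eqVlt => /orP[/eqP->|aA']; rewrite ?modnn ?(modn_small aA'); lia.
move: mA; rewrite eqn_mod_dvd// => /dvdnP[j jE]; exists j; first by rewrite -jE subnKC.
by rewrite /full_at negb_and -ltnNge.
Qed.

(** If the excludant is [a + j * A], then [full k p] holds exactly for [k <= j], so the sum counts
    [j]; [full_leq] puts [j] below [N]. *)
Lemma mes_fullE p N : (sumn (map fst p) < N)%N ->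
  mes r A a p = (a + A * \sum_(1 <= k < N) full k p)%N.
Proof.
move=> pN; have A0 : (0 < A)%N by exact: leq_trans aA.
have [mc mmin] := @mesP r A a p A0.
have [j mE nfull] := mes_cond_progression _ _ mc.
have fullE k : full k p = (k <= j)%N.
  apply/allP/idP => [fk|kj i]; first rewrite leqNgt; first apply/negP => jk.
    by move: nfull; rewrite mE fk// mem_iota.
  rewrite mem_iota add0n /= => ik; apply/negPn/negP => nfi.
  have /mmin : mes_cond r A a p (a + i * A).
    rewrite /mes_cond addnC modnMDl eqxx addn_gt0 a0 orbT /= addnC.
    by move: nfi; rewrite /full_at negb_and -ltnNge.
  by rewrite mE; nia.
have jN : (j < N)%N.
  by apply: leq_ltn_trans pN; rewrite full_leq// fullE.
rewrite mE mulnC; congr (_ + _ * _)%N; rewrite (@big_cat_nat _ _ _ j.+1)//=.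
rewrite [X in (_ + X)%N]big1_seq ?addn0 => [|k]; last first.
  by rewrite fullE mem_index_iota /= => /andP[/ltn_geF->].
rewrite (@eq_big_nat _ _ _ 1 j.+1 _ (fun=> 1%N)) => [|k].
  by rewrite sum_nat_const_nat; lia.
by rewrite ltnS fullE => /andP[_ ->].
Qed.

(** * Generating functions over truncated profiles *)

Definition gf (K : comNzRingType) (k N : nat) (q : K) : K :=
  \sum_(f : profiles N | full k (opart f)) q ^+ weight f.

(** The weight cutoff makes the partial sums over [n] exact, while [gf], without it, factors over
    sizes; both have the same limit. *)
Definition truncated_gf (K : comNzRingType) (k N : nat) (q : K) : K :=
  \sum_(f : profiles N | (weight f < N)%N && full k (opart f)) q ^+ weight f.

(** Expand each excludant by [mes_fullE] and exchange the sums. The constant [a] goes with [k = 0],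
    where [full] is vacuous. *)
Lemma sum_sigma_mesE (K : comNzRingType) (N : nat) (q : K) :
  \sum_(0 <= n < N) (sigma_mes r A a n)%:R * q ^+ n =
  a%:R * truncated_gf K 0 N q + A%:R * \sum_(1 <= k < N) truncated_gf K k N q.
Proof.
transitivity (\sum_(f : profiles N | (weight f < N)%N)
    (mes r A a (opart f))%:R * q ^+ weight f).
  rewrite big_mkord.
  under eq_bigr => n _ do
    rewrite (sigma_mes_profiles r A a N n (ltn_ord n)) natr_sum mulr_suml.
  rewrite (exchange_big_dep (fun f : profiles N => weight f < N)%N) /=; last first.
    by move=> n f _ /eqP->.
  apply: eq_bigr => f fN; by rewrite (big_pred1 (Ordinal fN)).
have tE k : truncated_gf K k N q =
    \sum_(f : profiles N | (weight f < N)%N) (full k (opart f))%:R * q ^+ weight f.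
  rewrite /truncated_gf big_mkcondr; apply: eq_bigr => f _.
  by case: full; rewrite ?mul1r ?mul0r.
under [X in _ = _ + _ * X]eq_bigr do rewrite tE.
rewrite tE exchange_big /= !mulr_sumr -big_split; apply: eq_bigr => f fN /=.
rewrite (mes_fullE _ N) ?sumn_opart// natrD natrM natr_sum mulrDl -mulrA mulr_suml.
by rewrite /full /= mul1r.
Qed.

(** At [z = q ^+ m] this is the factor of size [m], a truncation of [(1 + z) / (1 - z)];
    [full_size_gf] below truncates [z ^+ r / (1 - z)]. *)
Definition size_gf (K : comNzRingType) (N : nat) (z : K) : K :=
  \sum_(x : bool * 'I_N) z ^+ (x.1 + x.2).

Definition full_size_gf (K : comNzRingType) (N : nat) (z : K) : K :=
  \sum_(x : bool * 'I_N | x.1 && (r - 1 <= x.2)%N) z ^+ (x.1 + x.2).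

Lemma full_at_opart N (f : profiles N) (i : 'I_N) :
  full_at (opart f) i.+1 = (f i).1 && (r - 1 <= (f i).2)%N.
Proof.
rewrite /full_at -has_pred1 has_count !count_overpart_of ltn_ord extE /=.
by case: (f i).1.
Qed.

Definition progression k := [seq (a + j * A)%N | j <- iota 0 k].

(** Weight and fullness split size by size, so the sum over profiles distributes into a product. The
    hypothesis keeps every constrained size within the profiles. *)
Lemma gf_prod (K : comNzRingType) k N (q : K) :
  {in progression k, forall m, m <= N}%N ->
  gf K k N q = \prod_(i < N) (if i.+1 \in progression k
    then full_size_gf K N (q ^+ i.+1) else size_gf K N (q ^+ i.+1)).
Proof.
move=> kN.
pose c (i : 'I_N) (x : bool * 'I_N) :=
  (i.+1 \in progression k) ==> x.1 && (r - 1 <= x.2)%N.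
(* Writing the constraint as a 0/1 coefficient leaves unrestricted sums, to which distributivity
   applies. *)
transitivity (\prod_(i < N) \sum_(x : bool * 'I_N)
    (c i x)%:R * q ^+ (i.+1 * (x.1 + x.2))); last first.
  apply: eq_bigr => i _; rewrite /c /full_size_gf /size_gf; case: ifP => _ /=.
    rewrite [RHS]big_mkcond; apply: eq_bigr => x _.
    by case: (_ && _); rewrite ?mul1r ?mul0r// exprM.
  by apply: eq_bigr => x _; rewrite mul1r exprM.
rewrite bigA_distr_bigA /gf big_mkcond; apply: eq_bigr => f _.
rewrite big_split /= prodrXr -/(weight f).
suff -> : full k (opart f) = [forall i, c i (f i)].
  case: ifP => [/forallP cf|/negbT].
    by rewrite big1 ?mul1r// => i _; rewrite cf.
  by rewrite negb_forall => /existsP[i /negbTE ci]; rewrite (bigD1 i)//= ci !mul0r.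
apply/allP/forallP => [fk i|cf j jk].
  by apply/implyP => /mapP[j jk iE]; rewrite -full_at_opart iE fk.
have jN : (a + j * A \in progression k)%N by apply/mapP; exists j.
(* Index [i] carries size [i.+1], hence the predecessor. *)
have i0 : ((a + j * A).-1 < N)%N by have := kN _ jN; lia.
have iE : (Ordinal i0).+1 = (a + j * A)%N by rewrite /=; lia.
by have := cf (Ordinal i0); rewrite /c -full_at_opart iE jN.
Qed.

Lemma progression_leq k m : m \in progression k.+1 -> (m <= a + k * A)%N.
Proof. by case/mapP=> j; rewrite mem_iota => jk ->; nia. Qed.

(** The two products differ only in the factor of size [a + k * A]; cross-multiplying avoids
    division in the ring. *)
Lemma gf_rec (K : comNzRingType) k N (q : K) : (a + k * A <= N)%N ->
  gf K k.+1 N q * size_gf K N (q ^+ (a + k * A)) =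
  gf K k N q * full_size_gf K N (q ^+ (a + k * A)).
Proof.
move=> kN.
have sub m : m \in progression k -> m \in progression k.+1.
  by case/mapP=> j jk ->; apply/mapP; exists j => //; move: jk; rewrite !mem_iota; lia.
have i0 : ((a + k * A).-1 < N)%N by lia.
have iE : (Ordinal i0).+1 = (a + k * A)%N by rewrite /=; lia.
rewrite !gf_prod; first last.
- by move=> m /progression_leq /leq_trans; apply.
- by move=> m /sub/progression_leq /leq_trans; apply.
rewrite (bigD1 (Ordinal i0))// [in RHS](bigD1 (Ordinal i0))//= -/(_.+1) [_.+1]iE.
have -> : (a + k * A)%N \in progression k.+1.
  by apply/mapP; exists k => //; rewrite mem_iota add0n ltnSn.
have /negbTE -> : (a + k * A)%N \notin progression k.
  by apply/negP => /mapP[j]; rewrite mem_iota; nia.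
rewrite mulrAC [RHS]mulrAC [in RHS](mulrC (size_gf _ _ _)); congr (_ * _).
apply: eq_bigr => i ik; suff -> : (i.+1 \in progression k.+1) = (i.+1 \in progression k) by [].
apply/idP/idP => [/mapP[j]|/sub//]; rewrite mem_iota => jk ijE.
have [jE|jNk] := eqVneq j k; last by apply/mapP; exists j; rewrite // mem_iota; lia.
by move: ik; rewrite -val_eqE /= -eqSS ijE jE -iE eqxx.
Qed.

End MinimalExcludant.

(** * Closed forms and limits of the factor of one size *)

Section SizeGeneratingFunctions.
Variable r : nat.
Hypothesis r0 : (0 < r)%N.

Lemma size_gfE (K : comNzRingType) N (z : K) :
  size_gf K N z = (1 + z) * \sum_(c < N) z ^+ c.
Proof.
rewrite /size_gf -(pair_bigA _ (fun (b : bool) (c : 'I_N) => z ^+ (b + c))) /=.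
rewrite big_bool /= addrC mulrDl mul1r mulr_sumr; congr (_ + _).
by apply: eq_bigr => c _; rewrite exprS.
Qed.

Lemma full_size_gfE (K : comNzRingType) N (z : K) : (r - 1 <= N)%N ->
  full_size_gf r K N z = z * (\sum_(c < N) z ^+ c - \sum_(c < r - 1) z ^+ c).
Proof.
move=> rN; rewrite /full_size_gf big_mkcond /=.
rewrite -(pair_bigA _ (fun (b : bool) (c : 'I_N) =>
  if b && (r - 1 <= c)%N then z ^+ (b + c) else 0)) /=.
rewrite big_bool /= [X in _ + X]big1 // addr0.
rewrite -(big_mkord xpredT (fun c => if (r - 1 <= c)%N then z ^+ (1 + c) else 0)).
rewrite -!(big_mkord xpredT (GRing.exp z)) !(big_cat_nat (leq0n (r - 1)) rN) /=.
rewrite addrAC subrr add0r [X in X + _]big_nat big1 => [|c]; last by case: ltnP.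
rewrite add0r mulr_sumr; apply: eq_big_nat => c /andP[-> _].
by rewrite exprS.
Qed.

Lemma sum_exprE (F : fieldType) (z : F) N : z != 1 ->
  \sum_(c < N) z ^+ c = (1 - z ^+ N) / (1 - z).
Proof.
move=> z1; have z1' : 1 - z != 0 by rewrite subr_eq0 eq_sym.
by apply: (mulIf z1'); rewrite divfK// -[RHS]opprB subrX1 -mulNr opprB mulrC.
Qed.

Context {R : realType}.
Local Notation K := (complexField R).

Lemma modc_lt1_neq1 (z : K) : modc z < 1 -> z != 1.
Proof. by apply: contraTneq => ->; rewrite modc1 ltxx. Qed.

Lemma cvg_expr_modc (z : K) : modc z < 1 -> (fun N => z ^+ N) @ \oo --> (0 : K).
Proof.
move=> z1; apply: cvg_modc_squeeze (cvg_expr0 _ (modc_ge0 z) z1).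
by apply: nearW => N; rewrite subr0 modcX.
Qed.

Lemma cvg_sum_expr (z : K) : modc z < 1 ->
  (fun N => \sum_(c < N) z ^+ c) @ \oo --> (1 - z)^-1.
Proof.
move=> z1; rewrite [X in X @ _ --> _](_ : _ = fun N => (1 - z ^+ N) * (1 - z)^-1).
  rewrite [X in _ --> X](_ : _ = (1 - 0) * (1 - z)^-1); last by rewrite subr0 mul1r.
  apply: cvgM; last exact: cvg_cst.
  by apply: (@cvgB K K); [exact: cvg_cst|exact: cvg_expr_modc].
by apply/funext => N; rewrite sum_exprE ?modc_lt1_neq1.
Qed.

Lemma cvg_size_gf (z : K) : modc z < 1 ->
  (fun N => size_gf K N z) @ \oo --> (1 + z) / (1 - z).
Proof.
move=> z1.
rewrite [X in X @ _ --> _](_ : _ = fun N => (1 + z) * \sum_(c < N) z ^+ c).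
  by apply: cvgM; [exact: cvg_cst|exact: cvg_sum_expr].
by apply/funext => N; rewrite size_gfE.
Qed.

Lemma cvg_full_size_gf (z : K) : modc z < 1 ->
  (fun N => full_size_gf r K N z) @ \oo --> z ^+ r / (1 - z).
Proof.
move=> z1; have zn1 := modc_lt1_neq1 _ z1.
have -> : z ^+ r / (1 - z) = z * ((1 - z)^-1 - \sum_(c < r - 1) z ^+ c).
  rewrite sum_exprE// -{1}(subnKC r0) exprD expr1.
  have z1' : 1 - z != 0 by rewrite subr_eq0 eq_sym.
  by rewrite -mulrA; congr (_ * _); move: (z ^+ _) => w; field.
have c : (fun N => z * (\sum_(c < N) z ^+ c - \sum_(c < r - 1) z ^+ c)) @ \oo -->
    z * ((1 - z)^-1 - \sum_(c < r - 1) z ^+ c).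
  apply: cvgM; first exact: cvg_cst.
  by apply: (@cvgB K K); [exact: cvg_sum_expr|exact: cvg_cst].
apply: cvgn_near_eq c; near=> N.
by rewrite full_size_gfE//; near: N; exact: nbhs_infty_ge.
Unshelve. all: by end_near. Qed.

End SizeGeneratingFunctions.

(** * Limits and uniform bounds of the generating functions *)

Section GeneratingFunctionLimits.
Variables (r A a : nat).
Hypotheses (r0 : (0 < r)%N) (a0 : (0 < a)%N) (aA : (a <= A)%N).
Context {R : realType}.
Local Notation K := (complexField R).

Lemma gf0E (F : comNzRingType) N (q : F) :
  gf r A a F 0 N q = \prod_(i < N) size_gf F N (q ^+ i.+1).
Proof. by rewrite gf_prod. Qed.

(** With [z = t ^+ i.+1], each factor is at most [(1 + z) / (1 - z) = 1 + 2 * z / (1 - z)], hence at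
    most [1 + 2 / (1 - t) * t ^+ i]; [prod1D_expr_le] then gives a bound free of [N]. *)
Lemma gf0_le (t : R) N : 0 <= t -> t < 1 ->
  gf r A a R 0 N t <= expR (2 / (1 - t) / (1 - t)).
Proof.
move=> t0 t1; have t1' : 0 < 1 - t by rewrite subr_gt0.
have B0 : 0 <= 2 / (1 - t) by rewrite divr_ge0// ltW.
apply: le_trans (prod1D_expr_le _ _ t0 t1 B0 N).
rewrite gf0E big_mkord; apply: ler_prod => i _; apply/andP; split.
  by apply: sumr_ge0 => x _; rewrite !exprn_ge0.
have z1 : t ^+ i.+1 < 1 by rewrite exprn_ilt1.
have z0 : 0 <= t ^+ i.+1 by rewrite exprn_ge0.
have zt : t ^+ i.+1 <= t by rewrite exprS ler_piMr// exprn_ile1// ltW.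
have zi : t ^+ i.+1 <= t ^+ i by rewrite exprS ler_piMl ?exprn_ge0// ltW.
rewrite size_gfE sum_exprE ?lt_eqF//.
move: (t ^+ i.+1) z0 z1 zt zi => z z0 z1 zt zi.
have zN : 0 <= z ^+ N by rewrite exprn_ge0.
apply: (@le_trans _ _ ((1 + z) * (1 - z)^-1)).
  rewrite ler_wpM2l ?addr_ge0// ler_piMl ?invr_ge0; lra.
have -> : (1 + z) / (1 - z) = 1 + 2 * z / (1 - z) by field; lra.
rewrite lerD2l mulrAC -!mulrA ler_wpM2l// ler_pM ?invr_ge0; try lra.
by rewrite lef_pV2 ?posrE; lra.
Qed.

Variable q : K.
Hypothesis q1 : modc q < 1.

Lemma modc_exp_lt1 n : (0 < n)%N -> modc (q ^+ n) < 1.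
Proof. by move=> n0; rewrite modcX exprn_ilt1 ?modc_ge0// -lt0n. Qed.

(** Bounding multiplicities multiplies the product of [(1 + q ^+ m) / (1 - q ^+ m)] over [m <= N] by
    that of [1 - q ^+ (m * N)], which tends to 1. *)
Lemma cvg_gf0 : (fun N => gf r A a K 0 N q) @ \oo -->
  qpoch_inf (- q) q / qpoch_inf q q.
Proof.
have err : (fun N => \prod_(0 <= i < N) (1 - q ^+ (i.+1 * N))) @ \oo --> (1 : K).
  have q1' : 0 < 1 - modc q by rewrite subr_gt0.
  (* From [modc_prod1DB1_le] with [B = modc q ^+ N], after bounding [B] by 1 inside the
     exponential. *)
  pose C := expR ((1 - modc q)^-1) / (1 - modc q).
  apply: (@cvg_modc_squeeze _ _ _ (fun N => modc q ^+ N * C)); last first.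
    rewrite -[0](mul0r C); apply: cvgMl.
    exact: cvg_expr0 _ (modc_ge0 q) q1.
  near=> N.
  have N0 : (0 < N)%N by near: N; exact: nbhs_infty_gt.
  pose y i : K := if (i < N)%N then - q ^+ (i.+1 * N) else 0.
  rewrite (@eq_big_nat _ _ _ 0 N _ (fun i => 1 + y i)); last first.
    by move=> i /andP[_ iN]; rewrite /y iN.
  have B0 : 0 <= modc q ^+ N by rewrite exprn_ge0 ?modc_ge0.
  apply: le_trans (modc_prod1DB1_le (modc q) _ (modc_ge0 q) q1 B0 y _ N) _ => [i|].
    rewrite /y; case: ifP => _; last by rewrite modc0 mulr_ge0 ?exprn_ge0 ?modc_ge0.
    rewrite modcN modcX -exprD ler_wiXn2l ?modc_ge0 ?(ltW q1)//; nia.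
  rewrite /C -mulrA ler_wpM2l// ler_wpM2r ?invr_ge0 ?(ltW q1')// ler_expR.
  by rewrite ler_piMl ?invr_ge0 ?(ltW q1')// exprn_ile1 ?modc_ge0// ltW.
have c : (fun N => (\prod_(0 <= i < N) (1 - - q * q ^+ i)) /
    (\prod_(0 <= i < N) (1 - q * q ^+ i)) *
    \prod_(0 <= i < N) (1 - q ^+ (i.+1 * N))) @ \oo -->
    qpoch_inf (- q) q / qpoch_inf q q * 1.
  apply: cvgM err; apply: cvgM; first exact: cvg_qpoch_inf.
  by apply: cvgV; [exact: qpoch_inf_neq0|exact: cvg_qpoch_inf].
rewrite mulr1 in c; apply: cvgn_near_eq c; apply: nearW => N /=.
rewrite gf0E -(big_mkord xpredT (fun i => size_gf K N (q ^+ i.+1))) /=.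
rewrite -prodfV -!big_split /=; apply: eq_bigr => i _.
rewrite size_gfE sum_exprE ?modc_lt1_neq1 ?modc_exp_lt1//.
by rewrite mulNr opprK -exprS -exprM mulrA mulrAC.
Unshelve. all: by end_near. Qed.

Lemma qpoch_progression k : qpoch (- q ^+ a) (q ^+ A) k =
  \prod_(0 <= j < k) (1 + q ^+ (a + j * A)).
Proof.
rewrite qpochE ?modcN ?modc_exp_lt1 ?(leq_trans a0)//.
by apply: eq_bigr => j _; rewrite mulNr opprK -exprM -exprD mulnC.
Qed.

Lemma oneDexp_neq0 n : (0 < n)%N -> 1 + q ^+ n != 0.
Proof.
move=> n0; rewrite addr_eq0; apply/eqP => e.
by have := modc_exp_lt1 n n0; rewrite -modcN -e modc1 ltxx.
Qed.

(** By [gf_rec], passing from [k] to [k.+1] multiplies the limit by [z ^+ r / (1 + z)] with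
    [z = q ^+ (a + k * A)]; the exponents add up because ['C(k.+1, 2) = 'C(k, 2) + k]. *)
Lemma cvg_gf k : (fun N => gf r A a K k N q) @ \oo -->
  qpoch_inf (- q) q / qpoch_inf q q *
  (q ^+ (r * (A * 'C(k, 2) + k * a)) / qpoch (- q ^+ a) (q ^+ A) k).
Proof.
elim: k => [|k IHk].
  rewrite qpoch_progression big_geq// muln0 mul0n muln0 expr0 divr1 mulr1.
  exact: cvg_gf0.
have m0 : (0 < a + k * A)%N by rewrite addn_gt0 a0.
have z1 := modc_exp_lt1 _ m0.
have d0 : 1 - q ^+ (a + k * A) != 0.
  by rewrite subr_eq0 eq_sym modc_lt1_neq1.
have e0 : (1 + q ^+ (a + k * A)) / (1 - q ^+ (a + k * A)) != 0.
  by rewrite mulf_neq0 ?invr_eq0 ?oneDexp_neq0.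
rewrite [X in _ --> X](_ : _ = qpoch_inf (- q) q / qpoch_inf q q *
  (q ^+ (r * (A * 'C(k, 2) + k * a)) / qpoch (- q ^+ a) (q ^+ A) k) *
  ((q ^+ (a + k * A)) ^+ r / (1 - q ^+ (a + k * A)) /
  ((1 + q ^+ (a + k * A)) / (1 - q ^+ (a + k * A))))); last first.
  rewrite !qpoch_progression big_nat_recr//= -[RHS]mulrA; congr (_ * _).
  have -> : (r * (A * 'C(k.+1, 2) + k.+1 * a) =
      r * (A * 'C(k, 2) + k * a) + (a + k * A) * r)%N by rewrite binS bin1; lia.
  rewrite exprD (exprM q (a + k * A)%N r).
  move: (q ^+ (a + k * A)) d0 (oneDexp_neq0 _ m0) => z d0' d1.
  have -> : z ^+ r / (1 - z) / ((1 + z) / (1 - z)) = z ^+ r / (1 + z).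
    by rewrite invf_div mulrA divfK.
  by rewrite invfM mulrACA.
have c : (fun N => gf r A a K k N q * (full_size_gf r K N (q ^+ (a + k * A)) /
    size_gf K N (q ^+ (a + k * A)))) @ \oo -->
    qpoch_inf (- q) q / qpoch_inf q q *
    (q ^+ (r * (A * 'C(k, 2) + k * a)) / qpoch (- q ^+ a) (q ^+ A) k) *
    ((q ^+ (a + k * A)) ^+ r / (1 - q ^+ (a + k * A)) /
    ((1 + q ^+ (a + k * A)) / (1 - q ^+ (a + k * A)))).
  apply: cvgM IHk _; apply: cvgM; first exact: cvg_full_size_gf.
  by apply: cvgV; [exact: e0|exact: cvg_size_gf].
apply: cvgn_near_eq c; near=> N.
(* Division at finite [N] is legitimate: modulus below 1 excludes both [z = -1] and, for [N > 0],
   [z ^+ N = 1]. *)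
have sz0 : size_gf K N (q ^+ (a + k * A)) != 0.
  have N0 : (0 < N)%N by near: N; exact: nbhs_infty_gt.
  rewrite size_gfE sum_exprE ?modc_lt1_neq1// !mulf_neq0 ?invr_eq0 ?oneDexp_neq0//.
  by rewrite -exprM subr_eq0 eq_sym modc_lt1_neq1// modc_exp_lt1// muln_gt0 m0.
rewrite mulrA -gf_rec//; last by near: N; exact: nbhs_infty_ge.
by rewrite mulfK.
Unshelve. all: by end_near. Qed.


Let t : R := Num.sqrt (modc q).

Let t0 : 0 <= t.
Proof. exact: sqrtr_ge0. Qed.

Let t1 : t < 1.
Proof. by rewrite /t -sqrtr1 ltr_sqrt. Qed.

Let modc_exprE n : modc (q ^+ n) = t ^+ n * t ^+ n.
Proof. by rewrite modcX -exprMn -expr2 sqr_sqrtr ?modc_ge0. Qed.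

Let C : R := expR (2 / (1 - t) / (1 - t)).

(* Since [|q| = t ^ 2], one factor [t ^ weight f] pays for the bound and the
   other one keeps the sum over all profiles finite. *)
Let modc_sum_weight_le N (P : pred (profiles N)) n :
  (forall f, P f -> (n <= weight f)%N) ->
  modc (\sum_(f | P f) q ^+ weight f) <= C * t ^+ n.
Proof.
move=> Pn; apply: le_trans (modc_sum _ _ _ _) _; rewrite mulrC.
apply: le_trans (ler_wpM2l (exprn_ge0 n t0) (gf0_le t N t0 t1)).
rewrite /gf mulr_sumr [leLHS]big_mkcond; apply: ler_sum => f _; case: ifPn => [Pf|_].
  by rewrite modc_exprE ler_wpM2r ?exprn_ge0// ler_wiXn2l ?(ltW t1)//; exact: Pn.
by rewrite mulr_ge0 ?exprn_ge0.
Qed.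

(** Fullness up to [k] forces weight at least [k]; this is the domination that [tannery]
    requires. *)
Lemma modc_truncated_gf_le N k : modc (truncated_gf r A a K k N q) <= C * t ^+ k.
Proof.
apply: modc_sum_weight_le => f /andP[_] /full_leq; rewrite sumn_opart.
exact.
Qed.

(** The difference from [gf] sums over profiles of weight at least [N], hence is at most
    [C * t ^+ N] in modulus. *)
Lemma cvg_truncated_gf k : (fun N => truncated_gf r A a K k N q) @ \oo -->
  qpoch_inf (- q) q / qpoch_inf q q *
  (q ^+ (r * (A * 'C(k, 2) + k * a)) / qpoch (- q ^+ a) (q ^+ A) k).
Proof.
apply: (@cvg_sub0 K K _ _ _ _ (fun N => gf r A a K k N q) _ _ (cvg_gf k)).
apply: (@cvg_modc_squeeze _ _ _ (fun N => C * t ^+ N)); last first.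
  by rewrite -[0](mulr0 C); apply: cvgMr; exact: cvg_expr0.
apply: nearW => N /=; rewrite subr0 -modcN opprB.
rewrite /gf (bigID (fun f : profiles N => (weight f < N)%N)) /=.
rewrite [X in X + _ - _](_ : _ = truncated_gf r A a K k N q); last first.
  by apply: eq_bigl => f; rewrite andbC.
rewrite addrAC subrr add0r; apply: modc_sum_weight_le => f /andP[_].
by rewrite -leqNgt.
Qed.

End GeneratingFunctionLimits.

(** * Tannery's theorem applied to the sum over [k] *)

Theorem theorem2p6 (R : realType) (r A a : nat) (q : complexField R)
    (ha : (1 <= a)%N) (haA : (a <= A)%N) (hr : (2 <= r)%N) (hq : `|q| < 1) :
  let S := fun N : nat =>
    \sum_(1 <= k < N)
      q ^+ (r * (A * 'C(k, 2) + k * a)) / qpoch (- q ^+ a) (q ^+ A) k in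
  cvgn S /\
  (fun N : nat => \sum_(0 <= n < N) (sigma_mes r A a n)%:R * q ^+ n) @ \oo -->
    qpoch_inf (- q) q / qpoch_inf q q * (a%:R + A%:R * limn S).
Proof.
move=> S.
have q1 : modc q < 1 by rewrite modc_lt.
have r0 : (0 < r)%N by exact: ltnW.
pose P := qpoch_inf (- q) q / qpoch_inf q q.
(* Dividing by [P] recovers convergence of [S] from that of [P * S]. *)
have P0 : P != 0.
  by rewrite mulf_neq0 ?invr_eq0// qpoch_inf_neq0// modcN.
have t1 : Num.sqrt (modc q) < 1 by rewrite -sqrtr1 ltr_sqrt.
have cT k := cvg_truncated_gf r A a r0 ha haA q q1 k.
(* The sum starts at 1; the term [k = 0] is treated apart, as its coefficient is [a] instead of
   [A]. *)
have [cL cU] := tannery _ (sqrtr_ge0 _) t1 1 _ _ _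
  (modc_truncated_gf_le r A a ha haA q q1) cT.
have SE : (fun N => \sum_(1 <= k < N) P *
    (q ^+ (r * (A * 'C(k, 2) + k * a)) / qpoch (- q ^+ a) (q ^+ A) k)) =
    fun N => P * S N.
  by apply/funext => N; rewrite mulr_sumr.
rewrite SE in cL cU.
have cS : cvgn S.
  apply: (is_cvgn _ (P^-1 * limn (fun N => P * S N))).
  have c : (fun N => P^-1 * (P * S N)) @ \oo --> P^-1 * limn (fun N => P * S N).
    by apply: cvgM; [exact: cvg_cst|exact: cL].
  by apply: cvgn_near_eq c; apply: nearW => N; rewrite mulKf.
split; first exact: cS.
have limE : limn (fun N => P * S N) = P * limn S.
  by apply: cvgn_lim; apply: cvgM; [exact: cvg_cst|exact: cS].
rewrite limE in cU; rewrite -/P.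
have -> : P * (a%:R + A%:R * limn S) = a%:R * P + A%:R * (P * limn S) by ring.
have term0 : q ^+ (r * (A * 'C(0, 2) + 0 * a)) / qpoch (- q ^+ a) (q ^+ A) 0 = 1.
  rewrite (qpoch_progression A a ha haA q q1) big_geq//.
  by rewrite muln0 mul0n muln0 expr0 divr1.
have c0 := cT 0%N; rewrite term0 mulr1 in c0.
have c : (fun N => a%:R * truncated_gf r A a (complexField R) 0 N q +
    A%:R * \sum_(1 <= k < N) truncated_gf r A a (complexField R) k N q) @ \oo -->
    a%:R * P + A%:R * (P * limn S).
  apply: cvgD; (apply: cvgM; first exact: cvg_cst); [exact: c0|exact: cU].
by apply: cvgn_near_eq c; apply: nearW => N; rewrite sum_sigma_mesE.
Qed.
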